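(* Let $\epsilon>0$. Assume that $X\subseteq\mathbb{R}^n$ is bounded with diameter $D$ and that there exists $L>0$ such that $|C(x,\xi)-C(y,\xi)|\le L\|x-y\|_\infty$ for all $x,y\in X$, with probability 1. Suppose also that $t>0$ and $\delta\in(0,\alpha]$ are such that $M:=\inf_{x\in X}M_x>0$, where $M_x=F(0;x)-F_\epsilon(-t;x)+(\alpha-\delta)$. Then, for any $\beta\in(0,\delta]$, $$\mathbb{P}\left(X_{\epsilon,(\delta-\beta)}^{N,2t}\subseteq X_\alpha\right)\ge 1-\lceil 1/\beta\rceil\,\lceil 2LD/t\rceil^n\exp\left\{-2NM^2\right\}.$$
   Context: Let $X\subseteq\mathbb{R}^n$ be closed, $\xi$ a random vector in $\mathbb{R}^s$ with distribution $\mathbb{P}_\xi$, $\alpha\in(0,1)$, $c:\mathbb{R}^n\times\mathbb{R}^s\to\mathbb{R}^m$, and $C(x,\xi)=\max_{j=1,\dots,m}c_j(x,\xi)$. Standing assumption: for each $x\in X$ the random variable $C(x,\xi)$ has a continuous distribution. Put $F(t;x)=\mathbb{P}(C(x,\xi)\le t)$ and $X_\alpha=\{x\in X\mid F(0;x)\ge 1-\alpha\}$. For $\epsilon>0$ let $\Gamma_\epsilon:\mathbb{R}\to[0,1]$ be given by $\Gamma_\epsilon(y)=1$ for $y\le-\epsilon$, $\Gamma_\epsilon(y)=\gamma_\epsilon(y)$ for $-\epsilon<y<\epsilon$, $\Gamma_\epsilon(y)=0$ for $y\ge\epsilon$, where $\gamma_\epsilon:[-\epsilon,\epsilon]\to[0,1]$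 is strictly decreasing, symmetric (in the sense that $1-\gamma_\epsilon(y)=\gamma_\epsilon(-y)$), and such that $\Gamma_\epsilon$ is differentiable. Define $F_\epsilon(t;x)=\int_{\mathbb{R}^s}\Gamma_\epsilon(C(x,\xi)-t)\,d\mathbb{P}_\xi$ and, for an i.i.d. sample $\xi_1,\dots,\xi_N$ of $\xi$, $F_\epsilon^N(t;x)=\frac1N\sum_{i=1}^N\Gamma_\epsilon(C(x,\xi_i)-t)$. For $\delta\in[0,1]$ and $t\in\mathbb{R}$, $$X_{\epsilon,\delta}^{N,t}=\{x\in X\mid F_\epsilon^N(-t;x)\ge 1-\delta\}.$$ The outer probability is with respect to the sample.
   Formalization: The formal theorem assumes D > 0; when X is a single point (D = 0) the factor ⌈2LD/t⌉^n vanishes and the printed bound, which then claims probability 1, is false. *)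

(* Defs.v *)
From HB Require Import structures.
From mathcomp Require Import all_boot all_order all_algebra.
From mathcomp Require Import all_classical all_reals all_analysis.

Set Implicit Arguments.
Unset Strict Implicit.
Unset Printing Implicit Defensive.

Import Order.TTheory GRing.Theory Num.Theory.
Import numFieldNormedType.Exports.

Local Open Scope classical_set_scope.
Local Open Scope ring_scope.

(* The decision space R^n is 'rV[R]_n, whose library norm is the max-norm.
   The sample space R^s is s.-tuple R, which the library equips with the
   product (i.e. Borel) sigma-algebra. *)

(* The event of the main statement involves a quantifier over uncountably many
   decisions and need not be measurable; the value of P on such a set is
   meaningless, whereas the inner probability always makes sense and equals
   P A when A is measurable (inner_probE). *)
Definition inner_prob d (T : measurableType d) (R : realType)
    (P : probability T R) (A : set T) : \bar R :=
  ereal_sup [set P E | E in [set E | measurable E /\ E `<=` A]].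

Lemma inner_probE d (T : measurableType d) (R : realType)
    (P : probability T R) (A : set T) :
  measurable A -> inner_prob P A = P A.
Proof.
move=> mA; apply/eqP; rewrite eq_le; apply/andP; split.
  apply: ge_ereal_sup => _ [E [mE EA] <-].
  by apply: le_measure EA; rewrite inE.
by apply: ereal_sup_ubound; exists A => //; split => //; exact: subset_refl.
Qed.

Definition mutual_indep d d' (T : measurableType d) (U : measurableType d')
    (R : realType) (P : probability T R) (I : finType) (Y : I -> T -> U) :=
  forall (J : {set I}) (A : I -> set U), (forall i, measurable (A i)) ->
    P (\bigcap_(i in [set` J]) (Y i @^-1` A i))
    = (\prod_(i in J) P (Y i @^-1` A i))%E.

Definition iid_sample d d' (T : measurableType d) (U : measurableType d')
    (R : realType) (P : probability T R) (Q : probability U R)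
    (I : finType) (Y : I -> {RV P >-> U}) :=
  mutual_indep P (fun i => Y i : T -> U) /\
  forall i (A : set U), measurable A -> distribution P (Y i) A = Q A.

(* Diameter for the max-norm. *)
Definition diam (R : realType) n (X : set 'rV[R]_n) : R :=
  sup [set `|x - y| | x in X & y in X].

(* The maximum of the (at least one) coordinates of c x u. *)
Definition Cmax (R : realType) n s m
    (c : 'rV[R]_n -> s.-tuple R -> 'rV[R]_m.+1)
    (x : 'rV[R]_n) (u : s.-tuple R) : R :=
  \big[Num.max/c x u ord0 ord0]_(j < m.+1) c x u ord0 j.

Definition Gamma (R : realType) (eps : R) (gamma : R -> R) (y : R) : R :=
  if y <= - eps then 1 else if y < eps then gamma y else 0.

(* Only the values of gamma on [-eps, eps] matter. *)
Definition smoothing (R : realType) (eps : R) (gamma : R -> R) : Prop :=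
  [/\ forall y, - eps <= y <= eps -> 0 <= gamma y <= 1,
      forall y z, - eps <= y -> y < z -> z <= eps -> gamma z < gamma y,
      forall y, - eps <= y <= eps -> 1 - gamma y = gamma (- y) &
      forall y, derivable (Gamma eps gamma) y 1].

Section chance_constraint.
Context {R : realType} {n s m : nat}.
Variables (X : set 'rV[R]_n) (Pxi : probability (s.-tuple R) R).
Variable c : 'rV[R]_n -> s.-tuple R -> 'rV[R]_m.+1.

Definition F (t : R) (x : 'rV[R]_n) : R :=
  fine (Pxi [set u | Cmax c x u <= t]).

Definition Xalpha (alpha : R) : set 'rV[R]_n :=
  [set x | X x /\ F 0 x >= 1 - alpha].

Variables (eps : R) (gamma : R -> R).

Definition Feps (t : R) (x : 'rV[R]_n) : R :=
  \int[Pxi]_u Gamma eps gamma (Cmax c x u - t).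

Definition FepsN (N : nat) (xi : 'I_N -> s.-tuple R) (t : R)
    (x : 'rV[R]_n) : R :=
  N%:R^-1 * \sum_(i < N) Gamma eps gamma (Cmax c x (xi i) - t).

Definition XepsN (N : nat) (xi : 'I_N -> s.-tuple R) (delta t : R) :
    set 'rV[R]_n :=
  [set x | X x /\ FepsN xi (- t) x >= 1 - delta].

End chance_constraint.

(* Main.v *)
(* Cut [X] into cubes of side at most t/L and fix in each cube an infeasible
   point z, i.e. F(0;z) < 1 - alpha, if there is one.  If an infeasible x
   satisfies F_eps^N(-2t;x) >= 1 - delta + beta, then the point z of its cube
   satisfies F_eps^N(-t;z) >= 1 - delta + beta because C(z) <= C(x) + t, whereas
   M <= M_z and F(0;z) < 1 - alpha give F_eps(-t;z) + M < 1 - delta.  So some z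
   deviates from its mean by at least M, which by Hoeffding's inequality has
   probability at most exp(-2NM^2) for each of the ceil(2LD/t)^n cubes.
   Taking the representatives among the infeasible points makes a further
   partition according to the values of F(0;.), the source of the factor
   ceil(1/beta), unnecessary. *)

Require Import Defs.
From HB Require Import structures.
From mathcomp Require Import all_boot all_order all_algebra.
From mathcomp Require Import all_classical all_reals all_analysis.
From mathcomp Require Import measurable_realfun ring lra.

Set Implicit Arguments.
Unset Strict Implicit.
Unset Printing Implicit Defensive.

Import Order.TTheory GRing.Theory Num.Theory.
Import numFieldNormedType.Exports.

Local Open Scope classical_set_scope.
Local Open Scope ring_scope.

(** * Moment generating function of a Bernoulli variable *)

(** The expression is the derivative in [s] of [p * s + s ^+ 2 / 8 - ln (1 - p + p * expR s)]. It
    vanishes at 0, and its own derivative is [1/4 - a b / (a + b)^2] with [a = 1 - p] and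
    [b = p * expR s], nonnegative since [4 a b <= (a + b)^2]. *)
Lemma bernoulli_mgf_slope (R : realType) (p s : R) : 0 <= p <= 1 -> 0 <= s ->
  0 <= p + s / 4 - 1 + (1 - p) * (1 - p + p * expR s)^-1.
Proof.
move=> /andP[p0 p1] s0.
pose D (x : R) := 1 - p + p * expR x.
have D_ge1 x : 0 <= x -> 1 <= D x.
  move=> x0; rewrite /D -addrA lerDl addrC subr_ge0 ler_peMr//.
  by rewrite -expR0 ler_expR.
have dD (x : R) : is_derive x 1 D (p * expR x).
  by rewrite /D; apply: is_derive_eq; rewrite add0r mul1r.
pose h (x : R) := p + x / 4 - 1 + (1 - p) * (D x)^-1.
have dh (x : R) : 0 <= x ->
    is_derive x 1 h (4^-1 - (1 - p) * (p * expR x) / (D x) ^+ 2).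
  move=> x0; have D0 : D x != 0 by rewrite gt_eqF// (lt_le_trans ltr01)// D_ge1.
  have := is_deriveV D0 => dV.
  rewrite /h; apply: is_derive_eq.
  by rewrite /GRing.scale/=; field.
have dh1 (x : R) : 0 <= x -> derivable h x 1 by move=> x0; case: (dh x x0).
have hle : h 0 <= h s.
  apply: (@ger0_derive1_ndecry _ h 0 _ _ _ 0 s (lexx _) s0).
  - by move=> x; rewrite in_itv/= andbT => /ltW; exact: dh1.
  - move=> x; rewrite in_itv/= andbT => /ltW x0.
    rewrite derive1E; have /@derive_val -> := dh x x0.
    have D0 : 0 < D x by rewrite (lt_le_trans ltr01)// D_ge1.
    rewrite subr_ge0 ler_pdivrMr ?exprn_gt0//.
    rewrite -subr_ge0 (_ : _ - _ = (1 - p - p * expR x) ^+ 2 / 4).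
      by rewrite divr_ge0 ?sqr_ge0.
    by rewrite /D; field.
  - apply: derivable_within_continuous => x; rewrite in_itv/= andbT.
    exact: dh1.
have h0 : h 0 = 0.
  by rewrite /h /D expR0 mulr1 subrK invr1 mulr1 mul0r; ring.
by move: hle; rewrite h0.
Qed.

(** After taking logarithms, the difference of the two sides vanishes at 0 and is nondecreasing for
    [s >= 0] by [bernoulli_mgf_slope]. *)
Lemma bernoulli_mgf_le (R : realType) (p s : R) : 0 <= p <= 1 -> 0 <= s ->
  1 - p + p * expR s <= expR (p * s + s ^+ 2 / 8).
Proof.
move=> p01 s0; have /andP[p0 p1] := p01.
pose D (x : R) := 1 - p + p * expR x.
have D_gt0 x : 0 <= x -> 0 < D x.
  move=> x0; rewrite (lt_le_trans ltr01)// /D -addrA lerDl addrC subr_ge0.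
  by rewrite ler_peMr// -expR0 ler_expR.
have dD (x : R) : is_derive x 1 D (p * expR x).
  by rewrite /D; apply: is_derive_eq; rewrite add0r mul1r.
pose h (x : R) := p * x + x ^+ 2 / 8 - ln (D x).
have dh (x : R) : 0 <= x ->
    is_derive x 1 h (p + x / 4 - 1 + (1 - p) * (D x)^-1).
  move=> x0; have D0 := D_gt0 _ x0.
  have := is_derive1_ln D0 => dl.
  have dlD : is_derive x 1 (fun x => ln (D x)) ((D x)^-1 * (p * expR x)).
    have := @is_derive1_comp _ (@ln R) D x _ _ dl (dD x).
    by [].
  rewrite /h; apply: is_derive_eq.
  rewrite /GRing.scale/=.
  by rewrite /D in D0 *; field; rewrite gt_eqF.
have hle : h 0 <= h s.
  apply: (@ger0_derive1_ndecry _ h 0 _ _ _ 0 s (lexx _) s0).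
  - by move=> x; rewrite in_itv/= andbT => /ltW x0; case: (dh x x0).
  - move=> x; rewrite in_itv/= andbT => /ltW x0.
    rewrite derive1E; have /@derive_val -> := dh x x0.
    exact: bernoulli_mgf_slope.
  - apply: derivable_within_continuous => x; rewrite in_itv/= andbT => x0.
    by case: (dh x x0).
have h0 : h 0 = 0.
  by rewrite /h /D expR0 mulr1 subrK ln1 mulr0 expr0n mul0r; ring.
by move: hle; rewrite h0 subr_ge0 -ler_expR lnK ?posrE ?D_gt0.
Qed.

(** * Expectation of a product of independent variables *)

Lemma integral_indic_rv d d' (T : measurableType d) (U : measurableType d')
    (R : realType) (P : probability T R) (Y : {mfun T >-> U}) (A : set U) :
  measurable A -> (\int[P]_w (\1_A (Y w))%:E = P (Y @^-1` A))%E.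
Proof.
move=> mA; rewrite -[Y @^-1` A]setIT -integral_indic// -[_ @^-1` _]setTI.
exact: measurable_funPT.
Qed.

Section weighted.
Import HBNNSimple.

(** Passage from indicators to nonnegative measurable functions by simple approximation and monotone
    convergence. In the application [G] is the product of the other factors and [k] its
    expectation. *)
Lemma integral_weighted_rv d d' (T : measurableType d) (U : measurableType d')
    (R : realType) (P : probability T R) (Y : {mfun T >-> U}) (G : T -> R)
    (k : R) (f : U -> R) :
    measurable_fun setT G -> (forall w, 0 <= G w) -> 0 <= k ->
    (forall A, measurable A ->
      \int[P]_w (G w * \1_A (Y w))%:E = k%:E * P (Y @^-1` A))%E ->
    measurable_fun setT f -> (forall u, 0 <= f u) ->
  (\int[P]_w (G w * f (Y w))%:E = k%:E * \int[P]_w (f (Y w))%:E)%E.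
Proof.
move=> mG G0 k0 GA mf f0.
have mf' : measurable_fun setT (EFin \o f) by exact/measurable_EFinP.
pose f_ := nnsfun_approx measurableT mf'.
have mY : measurable_fun setT Y by exact: measurable_funPT.
(* The weight [H] is arbitrary because both [G] and the constant [k] are substituted for it;
   uniqueness of limits then gives the claim. *)
have lim_int (H : T -> R) : measurable_fun setT H -> (forall w, 0 <= H w) ->
    (\int[P]_w (H w * f_ n (Y w))%:E @[n --> \oo] -->
     \int[P]_w (H w * f (Y w))%:E)%E.
  move=> mH H0.
  have Hcvg w : (H w * f_ n (Y w))%:E @[n --> \oo] --> (H w * f (Y w))%:E.
    under eq_fun do rewrite EFinM.
    rewrite EFinM; apply: cvgeZl => //.
    apply: (@cvg_nnsfun_approx _ _ _ _ measurableT _ mf') => // u _.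
    by rewrite lee_fin f0.
  rewrite (_ : (\int[P]_w _)%E =
      (\int[P]_w limn (fun n => (H w * f_ n (Y w))%:E))%E); last first.
    by apply: eq_integral => w _; apply/esym/cvg_lim.
  apply: cvg_monotone_convergence => //.
  - move=> n; apply/measurable_EFinP; apply: measurable_funM => //.
    exact: measurableT_comp.
  - by move=> n w _; rewrite lee_fin mulr_ge0.
  - move=> w _ a b ab; rewrite lee_fin ler_wpM2l//.
    exact/lefP/nd_nnsfun_approx.
have fn (H : T -> R) n : measurable_fun setT H -> (forall w, 0 <= H w) ->
    (\int[P]_w (H w * f_ n (Y w))%:E =
     \sum_(r \in range (f_ n))
        (r%:E * \int[P]_w (H w * \1_(f_ n @^-1` [set r]) (Y w))%:E))%E.
  move=> mH H0.
  under eq_integral.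
    move=> w _; rewrite EFinM fimfunE -fsumEFin// ge0_mule_fsumr; last first.
      by move=> r; rewrite EFinM nnfun_muleindic_ge0.
    over.
  rewrite ge0_integral_fsum//; last 2 first.
  - move=> r; apply: emeasurable_funM; first exact/measurable_EFinP.
    apply/measurable_EFinP/measurable_funM => //.
    exact: measurableT_comp.
  - move=> r w _; rewrite EFinM mule_ge0 ?lee_fin//.
    by rewrite -lee_fin EFinM nnfun_muleindic_ge0.
  apply: eq_fsbigr => r /set_mem[u _ <-].
  rewrite -ge0_integralZl//; last 3 first.
  - apply/measurable_EFinP/measurable_funM => //.
    exact: measurableT_comp.
  - by move=> w _; rewrite lee_fin mulr_ge0.
  - by rewrite lee_fin.
  by apply: eq_integral => w _; rewrite -!EFinM mulrCA.
have fnE n : (\int[P]_w (G w * f_ n (Y w))%:E =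
     \int[P]_w (k * f_ n (Y w))%:E)%E.
  rewrite !fn//; apply: eq_fsbigr => r _; congr (_ * _)%E.
  have mA : measurable (f_ n @^-1` [set r]) by [].
  rewrite GA//; under [RHS]eq_integral do rewrite EFinM.
  rewrite ge0_integralZl_EFin//; last first.
    by apply/measurable_EFinP/(measurableT_comp _ mY); exact: measurable_indic.
  by rewrite integral_indic_rv.
have := lim_int _ mG G0; under eq_fun do rewrite fnE.
have := lim_int (cst k) (@measurable_cst _ _ _ _ _ _) (fun=> k0).
move=> kl Gl; rewrite -(cvg_unique _ kl Gl)//=.
rewrite -ge0_integralZl_EFin//.
  by move=> w _; rewrite lee_fin.
by apply/measurable_EFinP; exact: measurableT_comp.
Qed.


End weighted.

Lemma integral_prod_indep d d' (T : measurableType d) (U : measurableType d')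
    (R : realType) (P : probability T R) (I : finType) (Y : I -> {mfun T >-> U})
    (g : I -> U -> R) :
    mutual_indep P (fun i => Y i : T -> U) ->
    (forall i, measurable_fun setT (g i)) -> (forall i u, 0 <= g i u) ->
    (forall i, \int[P]_w (g i (Y i w))%:E < +oo)%E ->
  (\int[P]_w (\prod_i g i (Y i w))%:E = \prod_i \int[P]_w (g i (Y i w))%:E)%E.
Proof.
move=> indepY.
have mY i : measurable_fun setT (Y i) by exact: measurable_funPT.
(* Indicators are replaced by general functions one coordinate at a time;
   [s] lists the coordinates already replaced. *)
suff H (s : seq I) : forall g : I -> U -> R,
    (forall i, i \notin s -> exists2 A, measurable A & g i = \1_A) ->
    (forall i, measurable_fun setT (g i)) -> (forall i u, 0 <= g i u) ->
    (forall i, \int[P]_w (g i (Y i w))%:E < +oo)%E ->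
  (\int[P]_w (\prod_i g i (Y i w))%:E = \prod_i \int[P]_w (g i (Y i w))%:E)%E.
  by apply: (H (enum I)) => i; rewrite mem_enum.
elim: s => {g}[|k s IH] g gA mg g0 gfin.
  (* When every factor is an indicator, the product is the indicator of an intersection, and the
     claim is mutual independence over all indices. *)
  have /choice[A /all_and2[mA gE]] : forall i, exists A : set U,
      measurable A /\ g i = \1_A by move=> i; have [//|A] := gA i; exists A.
  have := indepY [set: I]%SET A mA.
  under eq_bigl do rewrite finset.in_setT.
  under [X in _ = X -> _]eq_bigr do rewrite -integral_indic_rv// -gE.
  move=> <-.
  have mcap : measurable (\bigcap_(i in [set` [set: I]%SET]) (Y i @^-1` A i)).
    apply: fin_bigcap_measurable => // i _.
    by rewrite -[_ @^-1` _]setTI; exact: mY.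
  rewrite -[X in P X]setIT -integral_indic//.
  apply: eq_integral => w _; congr (_%:E).
  rewrite indicE; have [|] := boolP (w \in _).
    move=> /set_mem wA; rewrite big1// => i _.
    by rewrite gE indicE mem_set//; apply: wA => /=; rewrite finset.in_setT.
  move=> wA; apply/eqP; rewrite -[_ == _]negbK.
  apply/negP => /prodf_neq0 w0; move/negP : wA; apply.
  apply/mem_set => i _ /=; have := w0 i isT.
  by rewrite gE indicE; case: (boolP (_ \in _)) => [/set_mem//|_]; rewrite eqxx.
pose c := (\prod_(i | i != k) \int[P]_w (g i (Y i w))%:E)%E.
have I0 i : (0 <= \int[P]_w (g i (Y i w))%:E)%E.
  by apply: integral_ge0 => w _; rewrite lee_fin.
have c0 : (0 <= c)%E by exact: prode_ge0.
have cfin : c \is a fin_num.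
  by apply: prode_fin_num => i _; rewrite ge0_fin_numE.
have mgY i : measurable_fun setT (fun w => g i (Y i w)).
  exact: measurableT_comp.
rewrite [RHS](bigD1 k)//= -/c muleC -(fineK cfin).
rewrite -(@integral_weighted_rv _ _ _ _ _ _ _
  (fun w => \prod_(i | i != k) g i (Y i w))) //.
- by apply: eq_integral => w _; rewrite (bigD1 k)//= mulrC.
- under eq_fun do rewrite -big_filter.
  exact: measurable_prod.
- by move=> w; apply: prodr_ge0.
- by rewrite fine_ge0.
move=> A mA; rewrite fineK//.
(* With [\1_A] put at coordinate [k], only the coordinates in [s] can fail to be indicators, so the
   induction hypothesis applies. *)
pose g' i := if i == k then \1_A else g i.
have g'k i : i != k -> g' i = g i by rewrite /g' => /negbTE ->.
have : (\int[P]_w (\prod_i g' i (Y i w))%:E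
        = \prod_i \int[P]_w (g' i (Y i w))%:E)%E.
  apply: IH => i.
  - rewrite /g'; case: eqVneq => [_ _|ik si]; first by exists A.
    by apply: gA; rewrite inE negb_or ik.
  - by rewrite /g'; case: ifP => // _; exact: measurable_indic.
  - by rewrite /g'; case: ifP.
  - rewrite /g'; case: eqVneq => [_|//].
    rewrite integral_indic_rv//.
    apply: le_lt_trans (probability_le1 P _) (ltry 1).
    by rewrite -[_ @^-1` _]setTI; exact: mY.
have -> : (\prod_i \int[P]_w (g' i (Y i w))%:E = P (Y k @^-1` A) * c)%E.
  rewrite (bigD1 k)//=; congr (_ * _)%E.
    by rewrite /g' eqxx integral_indic_rv.
  apply: eq_bigr => i ik; by under eq_integral do rewrite g'k//.
rewrite muleC => <-; apply: eq_integral => w _.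
rewrite [in RHS](bigD1 k)//= {1}/g' eqxx mulrC; congr (_ * _)%:E.
by apply: eq_bigr => i ik; rewrite g'k.
Qed.

(** * Hoeffding's inequality for variables with values in the unit interval *)

(** Convexity of the exponential: its tangent at [s * y] bounds it from below at [s] and at 0, and
    in the combination with weights [y] and [1 - y] the linear terms cancel. *)
Lemma expR_le_chord (R : realType) (s y : R) : 0 <= y <= 1 ->
  expR (s * y) <= 1 + (expR s - 1) * y.
Proof.
move=> /andP[y0 y1].
have e0 := expR_ge0 (s * y).
have es : expR s = expR (s * y) * expR (s * (1 - y)).
  by rewrite -expRD; congr expR; ring.
have e1 : 1 = expR (s * y) * expR (- (s * y)).
  by rewrite -expRD subrr expR0.
have h1 := ler_wpM2l e0 (expR_ge1Dx (s * (1 - y))).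
have h2 := ler_wpM2l e0 (expR_ge1Dx (- (s * y))).
rewrite -es in h1; rewrite -e1 in h2.
have k1 := ler_wpM2l y0 h1.
have y1' : 0 <= 1 - y by rewrite subr_ge0.
have k2 := ler_wpM2l y1' h2.
by nra.
Qed.

Section unit_interval_valued.
Context d (T : measurableType d) (R : realType) (P : probability T R).
Variable X : T -> R.
Hypotheses (mX : measurable_fun setT X) (X01 : forall w, 0 <= X w <= 1).

Lemma integral01_le1 : (\int[P]_w (X w)%:E <= 1)%E.
Proof.
rewrite -(@probability_setT _ _ _ P) -[leRHS]mul1e -integral_cst//.
apply: ge0_le_integral => //.
- by move=> w _; rewrite lee_fin; case/andP: (X01 w).
- exact/measurable_EFinP.
- by move=> w _; rewrite lee_fin; case/andP: (X01 w).
Qed.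

Lemma integral01_ge0 : (0 <= \int[P]_w (X w)%:E)%E.
Proof. by apply: integral_ge0 => w _; rewrite lee_fin; case/andP: (X01 w). Qed.

Lemma Rintegral01E : (\int[P]_w (X w)%:E = (\int[P]_w X w)%:E)%E.
Proof.
rewrite /Rintegral fineK// ge0_fin_numE ?integral01_ge0//.
exact: le_lt_trans integral01_le1 (ltry 1).
Qed.

Lemma Rintegral01 : 0 <= \int[P]_w X w <= 1.
Proof.
by rewrite -!lee_fin -Rintegral01E integral01_ge0 integral01_le1.
Qed.

(** The chord bound replaces [X] by a Bernoulli variable of the same mean, to which
    [bernoulli_mgf_le] applies. *)
Lemma hoeffding_mgf (s : R) : 0 <= s ->
  (\int[P]_w (expR (s * X w))%:E
    <= (expR (\int[P]_w X w * s + s ^+ 2 / 8))%:E)%E.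
Proof.
move=> s0; have es0 : 0 <= expR s - 1 by rewrite subr_ge0 -expR0 ler_expR.
have mZ : measurable_fun setT (fun w => ((expR s - 1) * X w)%:E).
  exact/measurable_EFinP/measurable_funM.
have Z0 w : [set: T] w -> (0 <= ((expR s - 1) * X w)%:E)%E.
  by move=> _; rewrite lee_fin mulr_ge0//; case/andP: (X01 w).
apply: (@le_trans _ _ (\int[P]_w (1 + ((expR s - 1) * X w)%:E))%E).
  apply: ge0_le_integral; first exact: measurableT.
  - by move=> w _; rewrite lee_fin expR_ge0.
  - apply/measurable_EFinP/measurableT_comp => //.
    exact: measurable_funM.
  - by apply: emeasurable_funD.
  - by move=> w _; rewrite -EFinD lee_fin expR_le_chord.
have one : (\int[P]_w 1 = 1 :> \bar R)%E.
  by rewrite (integral_cst P measurableT) mul1e; exact: probability_setT.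
rewrite ge0_integralD// one.
under eq_integral do rewrite EFinM.
rewrite ge0_integralZl_EFin//; last 2 first.
- by move=> w _; rewrite lee_fin; case/andP: (X01 w).
- exact/measurable_EFinP.
rewrite Rintegral01E -EFinM -EFinD lee_fin.
apply: le_trans (bernoulli_mgf_le Rintegral01 s0).
by rewrite le_eqVlt (_ : _ == _)//; apply/eqP; ring.
Qed.

End unit_interval_valued.

(** Chernoff's bound, where independence factors the moment generating function of the sum and
    [hoeffding_mgf] bounds each factor. *)
Lemma hoeffding d d' (T : measurableType d) (U : measurableType d')
    (R : realType) (P : probability T R) (I : finType) (Y : I -> {mfun T >-> U})
    (g : I -> U -> R) (r : R) :
    mutual_indep P (fun i => Y i : T -> U) ->
    (forall i, measurable_fun setT (g i)) ->
    (forall i u, 0 <= g i u <= 1) -> (0 < #|I|)%N -> 0 < r ->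
  (P [set w | (\sum_i \int[P]_v g i (Y i v) + r <= \sum_i g i (Y i w))%R]
    <= (expR (- 2 * r ^+ 2 / #|I|%:R))%:E)%E.
Proof.
move=> indepY mg g01 I0 r0.
have n0 : 0 < #|I|%:R :> R by rewrite ltr0n.
(* The minimiser of the exponent [#|I| * s^2 / 8 - s * r], with minimum [- 2 * r^2 / #|I|]. *)
pose s := 4 * r / #|I|%:R.
have s0 : 0 < s by rewrite divr_gt0// mulr_gt0.
have mgY i : measurable_fun setT (fun w => g i (Y i w)).
  exact: measurableT_comp.
have mS : measurable_fun setT (fun w => \sum_i g i (Y i w)).
  exact: measurable_sum.
pose S : {RV P >-> R} := HB.pack (fun w => \sum_i g i (Y i w))
  (isMeasurableFun.Build _ _ _ _ _ mS).
apply: (le_trans (chernoff S (\sum_i \int[P]_v g i (Y i v) + r) s0)).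
rewrite /mmt_gen_fun unlock.
have mgf i := @hoeffding_mgf _ _ _ P _ (mgY i) (fun w => g01 i (Y i w)) s
  (ltW s0).
have -> : (\int[P]_w ((expR \o s \o* S) w)%:E =
           \int[P]_w (\prod_i expR (s * g i (Y i w)))%:E)%E.
  apply: eq_integral => w _ /=; congr (_%:E).
  by rewrite -expR_sum -mulr_sumr mulrC.
rewrite (@integral_prod_indep _ _ _ _ _ _ _ _ (fun i u => expR (s * g i u)))//.
- set p := (\prod_i _)%E.
  have : (p <= \prod_i (expR (\int[P]_w g i (Y i w) * s + s ^+ 2 / 8))%:E)%E.
    (* Nonnegativity is carried along because multiplying inequalities in [\bar R] requires it. *)
    suff /andP[] : (0 <= p <= \prod_i
      (expR (\int[P]_w g i (Y i w) * s + s ^+ 2 / 8))%:E)%E by [].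
    apply: (big_ind2 (fun x y : \bar R => 0 <= x <= y)%E) => [|a b a' b'|i _].
    - by rewrite lexx lee01.
    - by move=> /andP[? ?] /andP[? ?]; rewrite mule_ge0//= lee_pmul.
    - rewrite mgf andbT.
      by apply: integral_ge0 => w _; rewrite lee_fin expR_ge0.
  rewrite prodEFin -expR_sum big_split/= sumr_const -mulr_suml => ple.
  apply: (le_trans (lee_wpmul2r _ ple)); first by rewrite lee_fin expR_ge0.
  rewrite -EFinM lee_fin -expRD ler_expR le_eqVlt (_ : _ == _)//; apply/eqP.
  set mu := \sum_i _; rewrite -(mulr_natr (s ^+ 2 / 8)) /s; field.
  by rewrite gt_eqF.
- move=> i; apply: measurableT_comp => //; exact: measurable_funM.
- move=> i; exact: le_lt_trans (mgf i) (ltry _).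
Qed.

(** * Union bound and properties of the smoothed step function *)

Lemma measure_bigsetU_le d (T : measurableType d) (R : realType)
    (mu : {measure set T -> \bar R}) (I : Type) (s : seq I) (A : I -> set T) :
  (forall i, measurable (A i)) ->
  (mu (\big[setU/set0]_(i <- s) A i) <= \sum_(i <- s) mu (A i))%E.
Proof.
move=> mA; elim: s => [|i s IH]; first by rewrite !big_nil measure0.
rewrite !big_cons; apply: le_trans (measureU2 _ _ _) _ => //.
  exact: bigsetU_measurable.
by rewrite leeD2l.
Qed.

Section Gamma_theory.
Context {R : realType} (eps : R) (gamma : R -> R).
Hypothesis smooth : smoothing eps gamma.

Lemma Gamma01 y : 0 <= Gamma eps gamma y <= 1.
Proof.
case: smooth => g01 _ _ _; rewrite /Gamma.
case: ifPn => [_|]; first by rewrite ler01 lexx.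
rewrite -ltNge => ey; case: ifPn => [ye|_]; last by rewrite ler01 lexx.
by apply: g01; rewrite !ltW.
Qed.

Lemma Gamma_nincr y z : y <= z -> Gamma eps gamma z <= Gamma eps gamma y.
Proof.
case: smooth => _ gdecr _ _ yz; have /andP[y0 _] := Gamma01 y.
have /andP[_ z1] := Gamma01 z; move: y0 z1; rewrite /Gamma.
have [ye|ey] := leP y (- eps); first by [].
have ez : - eps < z by exact: lt_le_trans yz.
rewrite (leNgt z) ez /=.
have [ze|ez'] := ltP z eps; last by [].
have -> : y < eps by exact: le_lt_trans ze.
move: yz; rewrite le_eqVlt => /predU1P[->|yz] _ _; first exact: lexx.
by apply: ltW; apply: gdecr => //; exact: ltW.
Qed.

Lemma measurable_Gamma : measurable_fun setT (Gamma eps gamma).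
Proof.
case: smooth => _ _ _ dG; apply: continuous_measurable_fun => y.
exact/differentiable_continuous/derivable1_diffP/dG.
Qed.

End Gamma_theory.

(** * Max-norm, diameter and grid *)

Lemma norm_coord_le (R : realType) n (x : 'rV[R]_n) j : `|x ord0 j| <= `|x|.
Proof.
rewrite [leRHS]/Num.norm/= mx_normrE.
exact: (le_bigmax 0 (fun ij : 'I_1 * 'I_n => `|x ij.1 ij.2|) (ord0, j)).
Qed.

Lemma norm_le_coord (R : realType) n (x : 'rV[R]_n) r : 0 <= r ->
  (forall j, `|x ord0 j| <= r) -> `|x| <= r.
Proof.
move=> r0 xr; rewrite [leLHS]/Num.norm/= mx_normrE.
apply/bigmax_leP; split => //.
by move=> [i j] _ /=; rewrite (ord1 i).
Qed.

Lemma dist_le_diam (R : realType) n (X : set 'rV[R]_n) (x y : 'rV[R]_n) :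
  bounded_set X -> X x -> X y -> `|x - y| <= diam X.
Proof.
move=> [B [_ bX]] Xx Xy; apply: ub_le_sup; last by exists x => //; exists y.
(* [bounded_set] bounds the norm by every radius strictly above [B], hence [B + 1]. *)
exists ((B + 1) + (B + 1)) => _ [a Xa] [b Xb] <-.
by apply: le_trans (ler_normB _ _) _; apply: lerD; apply: (bX (B + 1)) => //;
  rewrite ltrDl.
Qed.

(* The cells are half-open cubes of side [rho] on a grid anchored at the
   coordinatewise infimum of [X]. *)
Lemma grid_cover (R : realType) n (X : set 'rV[R]_n) (D rho : R) (k : nat) :
    0 < rho -> 0 <= D -> (forall x y, X x -> X y -> `|x - y| <= D) ->
    D / rho < k%:R ->
  exists cell : 'rV[R]_n -> {ffun 'I_n -> 'I_k},
    forall x y, X x -> X y -> cell x = cell y -> `|x - y| <= rho.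
Proof.
move=> rho0 D0 XD Dk.
have : 0 < k%:R :> R by rewrite (le_lt_trans _ Dk)// divr_ge0// ltW.
case: k Dk => [|k] Dk; rewrite ?ltxx// => _.
pose b j := inf [set x ord0 j | x in X].
pose u (x : 'rV[R]_n) j := (x ord0 j - b j) / rho.
have XDj x y j : X x -> X y -> x ord0 j - D <= y ord0 j.
  move=> Xx Xy; rewrite lerBlDr addrC -lerBlDr.
  apply: le_trans (XD _ _ Xx Xy); apply: le_trans (norm_coord_le _ j).
  by rewrite !mxE ler_norm.
have u0 x j : X x -> 0 <= u x j.
  move=> Xx; rewrite divr_ge0 ?(ltW rho0)// subr_ge0; apply: ge_inf.
    by exists (x ord0 j - D) => _ [y Xy <-]; exact: XDj.
  by exists x.
(* A rescaled coordinate may equal [D / rho], so the strictness of [D / rho < k] keeps the cell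
   index in range. *)
have uk x j : X x -> u x j < k.+1%:R.
  move=> Xx; apply: le_lt_trans Dk; rewrite ler_pM2r ?invr_gt0//.
  rewrite lerBlDr addrC -lerBlDr; apply: lb_le_inf.
    by exists (x ord0 j); exists x.
  by move=> _ [y Xy <-]; exact: XDj.
(* On [X] the truncation is in range, so [inord] preserves its value. Rescaled coordinates with
   equal integer parts differ by less than 1. *)
exists (fun x => [ffun j => inord (Num.trunc (u x j))]) => x y Xx Xy /ffunP xy.
apply: norm_le_coord (ltW rho0) _ => j; rewrite !mxE.
have := congr1 val (xy j); rewrite !ffunE /= !inordK ?truncn_lt_nat ?u0 ?uk//.
move=> uxy; have /andP[x1 x2] := truncn_itv (u0 x j Xx).
have /andP[y1 y2] := truncn_itv (u0 y j Xy).
have -> : x ord0 j - y ord0 j = (u x j - u y j) * rho.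
  by rewrite /u; field; rewrite gt_eqF.
rewrite normrM (gtr0_norm rho0) ler_piMl ?(ltW rho0)// ler_norml.
by rewrite uxy in x1 x2; rewrite -natr1 in x2 y2; lra.
Qed.

(** * Deviation of the sample average at one fixed decision *)

(** Multiplied by [N], the event says that a sum of [N] independent variables in the unit interval
    exceeds its mean by at least [N * M], so [hoeffding] applies with [r = N * M]. *)
Lemma FepsN_deviation (R : realType) (n s m N : nat)
    (Pxi : probability (s.-tuple R) R)
    (c : 'rV[R]_n -> s.-tuple R -> 'rV[R]_m.+1) (eps : R) (gamma : R -> R)
    d (Omega : measurableType d) (P : probability Omega R)
    (xi : 'I_N -> {RV P >-> s.-tuple R}) (t M : R) (x : 'rV[R]_n) :
    smoothing eps gamma -> (0 < N)%N -> iid_sample Pxi xi ->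
    measurable_fun setT (Cmax c x) -> 0 < M ->
  let B := [set w | Feps Pxi c eps gamma t x + M
                      <= FepsN c eps gamma (fun i => xi i w) t x] in
  measurable B /\ (P B <= (expR (- 2 * N%:R * M ^+ 2))%:E)%E.
Proof.
move=> smooth N0 [indep ident] mC M0 B.
pose g u := Gamma eps gamma (Cmax c x u - t).
have mg : measurable_fun setT g.
  apply: measurableT_comp (measurable_Gamma smooth) _.
  exact: measurable_funB.
have g01 u : 0 <= g u <= 1 by exact: Gamma01.
have N0' : 0 < N%:R :> R by rewrite ltr0n.
(* Change of variables: the law of each [xi i] is [Pxi]. *)
have Eg i : \int[P]_w g (xi i w) = Feps Pxi c eps gamma t x.
  rewrite /Feps /Rintegral; congr fine.
  rewrite -(@ge0_integral_distribution _ _ _ _ _ P (xi i) (EFin \o g));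
    last 2 first.
  - exact/measurable_EFinP.
  - by move=> u; rewrite lee_fin; case/andP: (g01 u).
  by apply: eq_measure_integral => A mA _; exact: ident.
have BE : B = [set w | \sum_i \int[P]_v g (xi i v) + N%:R * M
                         <= \sum_i g (xi i w)].
  apply/seteqP; split => w; rewrite /B /FepsN /= (eq_bigr _ (fun i _ => Eg i));
    by rewrite sumr_const card_ord -(mulr_natl (Feps _ _ _ _ _ _)) -mulrDr
               ler_pdivlMl.
split.
  rewrite BE -[X in measurable X]setTI; apply: measurable_fun_le => //.
  by apply: measurable_sum => i; exact: measurableT_comp.
rewrite BE; apply: le_trans (hoeffding indep (fun=> mg) (fun=> g01) _ _) _.
- by rewrite card_ord.
- exact: mulr_gt0.
rewrite card_ord lee_fin ler_expR le_eqVlt (_ : _ == _)//; apply/eqP.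
by field; rewrite gt_eqF.
Qed.

(** * Passage from the cell representatives to all of [X] *)

Theorem theorem3p13 (R : realType) (n s m : nat)
    (X : set 'rV[R]_n) (Pxi : probability (s.-tuple R) R)
    (c : 'rV[R]_n -> s.-tuple R -> 'rV[R]_m.+1) (alpha : R)
    (closedX : closed X)
    (alpha01 : 0 < alpha < 1)
    (measC : forall x, X x -> measurable_fun setT (Cmax c x))
    (contC : forall x, X x -> continuous (fun t : R => F Pxi c t x))
    (eps : R) (eps0 : 0 < eps)
    (gamma : R -> R) (smooth : smoothing eps gamma)
    (N : nat) (N0 : (0 < N)%N)
    (d : measure_display) (Omega : measurableType d) (P : probability Omega R)
    (xi : 'I_N -> {RV P >-> s.-tuple R}) (iid : iid_sample Pxi xi)
    (boundedX : bounded_set X)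
    (D : R) (defD : D = diam X) (D0 : 0 < D)
    (L : R) (L0 : 0 < L)
    (lipC : {ae Pxi, forall u, forall x y, X x -> X y ->
       `|Cmax c x u - Cmax c y u| <= L * `|x - y|})
    (t : R) (t0 : 0 < t)
    (delta : R) (delta_range : 0 < delta <= alpha)
    (M : R)
    (defM : M = inf [set F Pxi c 0 x - Feps Pxi c eps gamma (- t) x
                         + (alpha - delta) | x in X])
    (M0 : 0 < M)
    (beta : R) (beta_range : 0 < beta <= delta) :
  (inner_prob P
     [set w | XepsN X c eps gamma (fun i => xi i w) (delta - beta) (2 * t)
              `<=` Xalpha X Pxi c alpha]
   >= (1 - (Num.ceil (1 / beta))%:~R * (Num.ceil (2 * L * D / t))%:~R ^+ n
           * expR (- 2 * N%:R * M ^+ 2))%:E)%E.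
Proof.
have /andP[beta0 _] := beta_range.
set k := `|Num.ceil (2 * L * D / t)|%N.
have y0 : 0 < L * D / t by rewrite divr_gt0// mulr_gt0.
have y2 : 2 * L * D / t = 2 * (L * D / t) by rewrite !mulrA.
have kE : (Num.ceil (2 * L * D / t))%:~R = k%:R :> R.
  by rewrite -[RHS]/(k%:~R) /k gez0_abs// ltW// ceil_gt0 y2 mulr_gt0.
(* The factor 2 inside the ceiling provides the strict inequality required by [grid_cover]. *)
have Dk : D / (t / L) < k%:R.
  rewrite -kE; apply: lt_le_trans (ceil_ge _); rewrite y2.
  have -> : D / (t / L) = L * D / t by field; rewrite !gt_eqF.
  by lra.
have [cell cellP] := @grid_cover R n X D (t / L) k (divr_gt0 t0 L0) (ltW D0)
  (fun x y Xx Xy => ltac:(rewrite defD; exact: dist_le_diam)) Dk.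
pose bad := [set x | X x /\ F Pxi c 0 x < 1 - alpha].
(* The default is 0 if the cell has no bad point. The test in [dev] then ensures that a deviation
   event is formed only at a point of [X], where [Cmax] is known to be measurable. *)
pose rep e : 'rV[R]_n := xget 0 [set x | bad x /\ cell x = e].
pose dev e := if `[< bad (rep e) >] then
  [set w | Feps Pxi c eps gamma (- t) (rep e) + M
             <= FepsN c eps gamma (fun i => xi i w) (- t) (rep e)] else set0.
have devP e : measurable (dev e) /\
    (P (dev e) <= (expR (- 2 * N%:R * M ^+ 2))%:E)%E.
  rewrite /dev; case: asboolP => [[Xr _]|_].
    by apply: FepsN_deviation => //; exact: measC.
  by split => //; rewrite measure0 lee_fin expR_ge0.
have [mdev Pdev] : (forall e, measurable (dev e)) /\
    (forall e, P (dev e) <= (expR (- 2 * N%:R * M ^+ 2))%:E)%E.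
  by split=> e; case: (devP e).
(* Outside the single null set [Z] the Lipschitz bound holds for all pairs at once; its preimages
   under the [xi i] are null because they have law [Pxi]. *)
have [Z [mZ PZ0 lipZ]] := lipC.
pose null i := xi i @^-1` Z.
have mnull i : measurable (null i).
  by rewrite /null -[_ @^-1` _]setTI; exact: measurable_funPT.
have Pnull i : P (null i) = 0%E by rewrite -PZ0 -(iid.2 i).
pose E1 := \big[setU/set0]_(i <- enum 'I_N) null i.
pose E2 := \big[setU/set0]_(e <- enum {ffun 'I_n -> 'I_k}) dev e.
have mE1 : measurable E1 by exact: bigsetU_measurable.
have mE2 : measurable E2 by exact: bigsetU_measurable.
have PE : (P (E1 `|` E2) <= (k%:R ^+ n * expR (- 2 * N%:R * M ^+ 2))%:E)%E.
  apply: le_trans (measureU2 _ mE1 mE2) _.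
  have E1le : (P E1 <= 0)%E.
    apply: le_trans (measure_bigsetU_le _ _ mnull) _.
    by rewrite big1 => // i _; exact: Pnull.
  apply: le_trans (leeD2r _ E1le) _; rewrite add0e.
  apply: le_trans (measure_bigsetU_le _ _ mdev) _.
  apply: (@le_trans _ _ (\sum_(e <- enum {ffun 'I_n -> 'I_k})
    (expR (- 2 * N%:R * M ^+ 2))%:E)%E).
    by apply: lee_sum => e _; exact: Pdev.
  rewrite sumEFin lee_fin big_enum sumr_const card_ffun !card_ord.
  by rewrite -(mulr_natl (expR _)) natrX.
have mE : measurable (~` (E1 `|` E2)) by apply: measurableC; exact: measurableU.
apply: (@le_trans _ _ (P (~` (E1 `|` E2)))).
  rewrite probability_setC; last exact: measurableU.
  apply: le_trans (leeB (lexx _) PE); rewrite -EFinB lee_fin lerD2l lerN2 kE.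
  (* The ceiling of the positive number [1 / beta] is at least 1, so this factor only enlarges the
     subtracted term. *)
  rewrite -(mulrA _%:~R) ler_peMl ?mulr_ge0 ?exprn_ge0 ?expR_ge0 ?ler0n//.
  by rewrite ler1z -gtz0_ge1 ceil_gt0 divr_gt0.
(* The complement of the exceptional set is the measurable subset that witnesses the inner
   probability. *)
apply: ereal_sup_ubound; exists (~` (E1 `|` E2)) => //.
split => // w nE x [Xx xN].
split => //; rewrite leNgt; apply/negP => Fx.
have wdev : ~ dev (cell x) w.
  move=> wd; apply: nE; right; rewrite /E2 -bigcup_seq; exists (cell x) => //=.
  by rewrite mem_enum.
have wnull i : ~ Z (xi i w).
  move=> wZ; apply: nE; left; rewrite /E1 -bigcup_seq; exists i => //=.
  by rewrite mem_enum.
have /(xgetPex 0) : exists y, bad y /\ cell y = cell x by exists x.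
rewrite -/(rep (cell x)) => -[brep crep]; apply: wdev.
rewrite /dev asboolT//=; set z := rep (cell x) in brep crep *.
have [Xz Fz] := brep.
have Mz : M <= F Pxi c 0 z - Feps Pxi c eps gamma (- t) z + (alpha - delta).
  rewrite defM; apply: ge_inf; last by exists z.
  (* [inf] is a lower bound only for a set bounded below; here [F >= 0] and [Feps <= 1] give this
     bound. *)
  exists (-1 + (alpha - delta)) => _ [y Xy <-]; rewrite lerD2r.
  have Gs u := Gamma01 smooth u.
  have /andP[_ F1] : 0 <= Feps Pxi c eps gamma (- t) y <= 1.
    apply: Rintegral01 => //.
    apply: measurableT_comp (measurable_Gamma smooth) _.
    by apply: measurable_funB => //; exact: measC.
  have F0 : 0 <= F Pxi c 0 y by rewrite fine_ge0.
  lra.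
(* Samplewise, [Cmax c z + t <= Cmax c x + 2 * t], since [z] and [x] are at distance at most
   [t / L]; [Gamma] reverses the inequality. *)
have Nz : FepsN c eps gamma (fun i => xi i w) (- (2 * t)) x
    <= FepsN c eps gamma (fun i => xi i w) (- t) z.
  rewrite /FepsN ler_wpM2l ?invr_ge0// ler_sum// => i _.
  apply: Gamma_nincr => //.
  have lip : `|Cmax c z (xi i w) - Cmax c x (xi i w)| <= L * `|z - x|.
    apply: contrapT => nlip; apply: (wnull i).
    by apply: lipZ => /= /(_ z x Xz Xx).
  have zx := cellP _ _ Xz Xx crep.
  have := le_trans lip (ler_wpM2l (ltW L0) zx).
  rewrite [L * _]mulrC divfK ?gt_eqF// => /(le_trans (ler_norm _)).
  lra.
(* The chain is [Feps z + M <= F 0 z + alpha - delta < 1 - delta < 1 - (delta - beta) <= FepsN x <=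
   FepsN z], with [Feps] and [FepsN z] taken at [- t] and [FepsN x] at [- (2 * t)]. *)
by move: xN => /= xN; lra.
Qed.
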